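(* Consider $k\ge2$ species with charges $q_h$, initial densities $\widetilde{n_{h0}}:\mathbb{R}\to[0,\infty)$ satisfying $\sum_{h=1}^kq_h\widetilde{n_{h0}}\equiv0$, and functions $Z_h,n_h,\beta_h^z$ of $(x^0,z)$ such that $Z_h$ is $C^1$, $Z_h(x^0,z)=z$ for $x^0\le z$, and $$n_h(x^0,z)=\widetilde{n_{h0}}[Z_h(x^0,z)]\,\partial_zZ_h(x^0,z),\qquad \widetilde{n_{h0}}[Z_h(x^0,z)]\,\partial_0Z_h(x^0,z)+n_h(x^0,z)\beta_h^z(x^0,z)=0 .$$ For any $\bar Z\in\mathbb{R}$, the function $$E^z(x^0,z)=4\pi\sum_{h=1}^kq_h\,\widetilde N_h[Z_h(x^0,z)],\qquad \widetilde N_h(Z):=\int_{\bar Z}^Z\widetilde{n_{h0}}(Z')\,dZ',$$ solves $$\partial_zE^z=4\pi\sum_{h=1}^kq_hn_h,\qquad \partial_0E^z=-4\pi\sum_{h=1}^kq_hn_h\beta_h^z,\qquad E^z(x^0,z)=0\ \text{ if } x^0\le z ;$$ moreover the neutrality condition $\sum_hq_h\widetilde{n_{h0}}\equiv0$ implies $\sum_{h=1}^kq_h\widetilde N_h(Z)\equiv0$.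
   Context: Setting: a plane-symmetric cold plasma whose fields depend only on $(x^0,z)$, $x^0=ct$; $\partial_0=\partial/\partial x^0$, $\partial_z=\partial/\partial z$. $Z_h(x^0,z)$ is the initial longitudinal position of the element of the $h$-th fluid which is located at $z$ at time $x^0$; $n_h$ is the (Eulerian) number density, $\beta_h^z$ the longitudinal velocity divided by $c$, and $E^z$ the longitudinal electric field. The two relations assumed between $n_h,\beta_h^z,Z_h$ express conservation of the number of particles and of the label $Z_h$ along the motion. The densities $\widetilde{n_{h0}}$ are such that $\widetilde N_h$ is a primitive of $\widetilde{n_{h0}}$, i.e. $\widetilde N_h'=\widetilde{n_{h0}}$ (e.g. $\widetilde{n_{h0}}$ continuous). *)

(* Defs.v *)
From mathcomp Require Import all_boot all_order all_algebra.
From mathcomp Require Import all_classical all_reals all_analysis.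
Set Implicit Arguments.
Unset Strict Implicit.
Unset Printing Implicit Defensive.
Import Order.TTheory GRing.Theory Num.Theory.
Import numFieldNormedType.Exports.
Local Open Scope classical_set_scope.
Local Open Scope ring_scope.

(* A field on the plane is a curried function u, with u x0 z its value at
   (x^0, z), where x^0 = c t. *)

Definition d0 {R : realType} (u : R -> R -> R) (x0 z : R) : R :=
  derive1 (u ^~ z) x0.

Definition dz {R : realType} (u : R -> R -> R) (x0 z : R) : R :=
  derive1 (u x0) z.

Definition C1_plane {R : realType} (u : R -> R -> R) : Prop :=
  [/\ forall x0 z, derivable (u ^~ z) x0 1,
      forall x0 z, derivable (u x0) z 1,
      continuous (fun p : R * R => d0 u p.1 p.2) &
      continuous (fun p : R * R => dz u p.1 p.2)].

(* Lebesgue integral of f from a to b, with the usual sign when b < a. *)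
Definition oriented_integral {R : realType} (f : R -> R) (a b : R) : R :=
  if a <= b then (\int[@lebesgue_measure R]_(t in `[a, b]) f t)%R
  else - (\int[@lebesgue_measure R]_(t in `[b, a]) f t)%R.

(* The longitudinal electric field, in Gaussian units, for the charges q, the
   initial densities n0 and the reference point Zbar. *)
Definition Efield {R : realType} (k : nat) (q : 'I_k -> R)
    (n0 : 'I_k -> R -> R) (Zbar : R) (Z : 'I_k -> R -> R -> R)
    (x0 z : R) : R :=
  4 * pi * \sum_(h < k) q h * oriented_integral (n0 h) Zbar (Z h x0 z).

(* Main.v *)
(** The Maxwell equations are the chain rule applied to the primitives N_h along
    z |-> Z_h(x0, z) and x0 |-> Z_h(x0, z).  By neutrality \sum_h q_h N_h has
    zero derivative, and it vanishes at Zbar, so it is identically 0; the field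
    is this sum evaluated at z wherever Z_h(x0, z) = z for all h. *)
Require Import Defs.
From mathcomp Require Import all_boot all_order all_algebra.
From mathcomp Require Import all_classical all_reals all_analysis.
Import Order.TTheory GRing.Theory Num.Theory.
Import numFieldNormedType.Exports.
Local Open Scope classical_set_scope.
Local Open Scope ring_scope.

Lemma is_derive_lincomb {R : realType} (k : nat) (a : 'I_k -> R)
    (f : 'I_k -> R -> R) (df : 'I_k -> R) (x : R) :
  (forall h, is_derive x (1 : R) (f h) (df h)) ->
  is_derive x (1 : R) (fun y => \sum_(h < k) a h * f h y)
    (\sum_(h < k) a h * df h).
Proof.
move=> fdf; rewrite [X in is_derive _ _ X _](_ : _ = \sum_(h < k) a h \*: f h).
  by apply: is_derive_sum => h; exact: is_deriveZ.
by apply/funext => y; rewrite fct_sumE.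
Qed.

Lemma oriented_integral_diag {R : realType} (f : R -> R) (a : R) :
  oriented_integral f a a = 0.
Proof. by rewrite /oriented_integral lexx set_itv1 Rintegral_set1. Qed.

(** Linearity and the chain rule, with one variable frozen: [g h] will be [Z h x0] for the
    [z]-derivative and [Z h ^~ z] for the [x0]-derivative, so both Maxwell equations are
    instances. *)
Lemma is_derive_field_along {R : realType} (k : nat) (c : R) (q : 'I_k -> R)
    (n0 N g : 'I_k -> R -> R) (x : R) :
  (forall h s, is_derive s (1 : R) (N h) (n0 h s)) ->
  (forall h, derivable (g h) x 1) ->
  is_derive x (1 : R) (fun y => c * \sum_(h < k) q h * N h (g h y))
    (c * \sum_(h < k) q h * (n0 h (g h x) * derive1 (g h) x)).
Proof.
move=> Nn0 dg.
apply: (@is_deriveZ _ _ _ (fun y => \sum_(h < k) q h * N h (g h y))).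
apply: (@is_derive_lincomb _ _ _ (fun h => N h \o g h)) => h.
by apply: is_derive1_comp; rewrite derive1E; exact: derivableP.
Qed.

Theorem proposition2 (R : realType) (k : nat) (k_ge2 : (2 <= k)%N)
  (q : 'I_k -> R) (n0 : 'I_k -> R -> R)
  (Z n beta : 'I_k -> R -> R -> R) (Zbar : R)
  (n0_ge0 : forall (h : 'I_k) (s : R), 0 <= n0 h s)
  (n0_loc : forall h : 'I_k, locally_integrable [set: R] (n0 h))
  (n0_primitive : forall (h : 'I_k) (s : R),
     is_derive s (1 : R) (oriented_integral (n0 h) Zbar) (n0 h s))
  (neutral : forall s : R, \sum_(h < k) q h * n0 h s = 0)
  (Z_C1 : forall h : 'I_k, C1_plane (Z h))
  (Z_init : forall (h : 'I_k) (x0 z : R), x0 <= z -> Z h x0 z = z)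
  (n_def : forall (h : 'I_k) (x0 z : R),
     n h x0 z = n0 h (Z h x0 z) * dz (Z h) x0 z)
  (Z_transport : forall (h : 'I_k) (x0 z : R),
     n0 h (Z h x0 z) * d0 (Z h) x0 z + n h x0 z * beta h x0 z = 0) :
  [/\ forall x0 z : R,
        is_derive z (1 : R) (Efield q n0 Zbar Z x0)
          (4 * pi * \sum_(h < k) q h * n h x0 z),
      forall x0 z : R,
        is_derive x0 (1 : R) (fun t : R => Efield q n0 Zbar Z t z)
          (- (4 * pi * \sum_(h < k) q h * n h x0 z * beta h x0 z)),
      forall x0 z : R, x0 <= z -> Efield q n0 Zbar Z x0 z = 0 &
      forall s : R,
        \sum_(h < k) q h * oriented_integral (n0 h) Zbar s = 0].
Proof.
have neutral_primitive s :
    \sum_(h < k) q h * oriented_integral (n0 h) Zbar s = 0.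
  transitivity (\sum_(h < k) q h * oriented_integral (n0 h) Zbar Zbar); last first.
    by rewrite big1 // => h _; rewrite oriented_integral_diag mulr0.
  (* A function on the line with zero derivative takes equal values at any two points, here [s] and
     [Zbar]. *)
  apply: (@is_derive_0_is_cst _
    (fun s => \sum_(h < k) q h * oriented_integral (n0 h) Zbar s)) => t.
  apply: is_derive_eq (neutral t).
  exact: (is_derive_lincomb k q (fun h => oriented_integral (n0 h) Zbar)).
split=> // [x0 z|x0 z|x0 z x0z].
(* Particle conservation [n_def] puts the charge density in the form that the chain rule
   produces. *)
- rewrite (eq_bigr (fun h => q h * (n0 h (Z h x0 z) * dz (Z h) x0 z))).
    by apply: is_derive_field_along => // h; case: (Z_C1 h).
  by move=> h _; rewrite n_def.
(* The minus sign goes inside the sum because [Z_transport] gives, species by species, [- (n h x0 z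
   * beta h x0 z) = n0 h (Z h x0 z) * d0 (Z h) x0 z], which is again the chain-rule form. *)
- rewrite -mulrN -sumrN.
  rewrite (eq_bigr (fun h => q h * (n0 h (Z h x0 z) * d0 (Z h) x0 z))).
    apply: (is_derive_field_along k _ q n0 _ (fun h => Z h ^~ z)) => // h.
    by case: (Z_C1 h).
  by move=> h _; rewrite -mulrA -(addr0_eq (Z_transport h x0 z)) mulrN opprK.
- rewrite /Efield; under eq_bigr do rewrite Z_init//.
  by rewrite neutral_primitive mulr0.
Qed.
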